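(* Let $\theta,\eta$ be irrational real numbers, let $\varpi_\upsilon=\varpi_\upsilon(\theta,\eta)>1$, and let $\mathfrak{g}_{\varpi_\upsilon}$ be the largest root of the polynomial $$G_{\varpi_\upsilon}(x)=x^2-(\varpi_\upsilon^2-2\varpi_\upsilon+3)\,x+1.$$ Then $$\max(\omega(\theta),\omega(\eta))\ \ge\ \mathfrak{g}_{\varpi_\upsilon}\ >\ \varpi_\upsilon.$$
   Context: $\|x\|$ denotes the distance from the real number $x$ to the nearest integer, and $\mathbb{Z}_+$ is the set of positive integers. For an irrational real number $\theta$ and real $t\ge1$ define $$\psi_\theta(t)=\min_{q\in\mathbb{Z}_+:\,q\le t}\|q\theta\|,\qquad \upsilon_\theta(t)=\min_{q\in\mathbb{Z}_+:\,q\le t} q\cdot\|q\theta\|,$$ and the ordinary Diophantine exponent $$\omega(\theta)=\sup\{\gamma\in\mathbb{R}:\ \liminf_{t\to\infty}t^{\gamma}\psi_\theta(t)<\infty\}.$$ For two irrational real numbers $\theta,\eta$ define $\upsilon_{\theta,\eta}(t)=\min(\upsilon_\theta(t),\upsilon_\eta(t))$ and $$\varpi_\upsilon(\theta,\eta)=\sup\{\gamma\in\mathbb{R}:\ \limsup_{t\to\infty}t^{\gamma-1}\upsilon_{\theta,\eta}(t)<\infty\}.$$ *)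

(* Defs.v *)
From mathcomp Require Import all_boot all_order all_algebra.
From mathcomp Require Import all_classical all_reals all_analysis.
From mathcomp Require Import ring lra.
Import Order.TTheory GRing.Theory Num.Theory.
Import numFieldNormedType.Exports.

Set Implicit Arguments.
Unset Strict Implicit.
Unset Printing Implicit Defensive.

Local Open Scope classical_set_scope.
Local Open Scope ring_scope.

(* The infimum is attained at floor x or ceil x, see [dist_int_attained]. *)
Definition dist_int (R : realType) (x : R) : R :=
  inf [set `|x - z%:~R| | z in [set: int]].

(* For t >= 1 this is a minimum, see [min_upto_attained]; for t < 1 the set is
   empty and the value is the junk value 0. *)
Definition min_upto (R : realType) (f : nat -> R) (t : R) : R :=
  inf [set f q | q in [set q : nat | (0 < q)%N /\ q%:R <= t]].

Definition psi (R : realType) (theta t : R) : R :=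
  min_upto (fun q => dist_int (q%:R * theta)) t.

Definition upsilon (R : realType) (theta t : R) : R :=
  min_upto (fun q => q%:R * dist_int (q%:R * theta)) t.

Definition upsilon2 (R : realType) (theta eta t : R) : R :=
  Num.min (upsilon theta t) (upsilon eta t).

(* Both exponents are suprema in the extended reals: they can be +oo. *)
Definition omega (R : realType) (theta : R) : \bar R :=
  ereal_sup [set gamma%:E | gamma in
    [set gamma : R |
      (limf_einf (fun t : R => (t `^ gamma * psi theta t)%:E) +oo%R < +oo)%E]].

Definition varpi_upsilon (R : realType) (theta eta : R) : \bar R :=
  ereal_sup [set gamma%:E | gamma in
    [set gamma : R |
      (limf_esup (fun t : R => (t `^ (gamma - 1) * upsilon2 theta eta t)%:E)
         +oo%R < +oo)%E]].

Definition G (R : realType) (w : R) : {poly R} :=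
  'X^2 - (w ^+ 2 - 2 * w + 3) *: 'X + 1.

Definition largest_root (R : realType) (p : {poly R}) (x : R) : Prop :=
  root p x /\ forall y : R, root p y -> y <= x.

Lemma inf_min (R : realType) (A : set R) (m : R) :
  A m -> lbound A m -> inf A = m.
Proof.
move=> Am lbm; apply/eqP; rewrite eq_le; apply/andP; split.
- by apply: ge_inf => //; exists m.
- by apply: lb_le_inf => //; exists m.
Qed.

Lemma dist_int_attained (R : realType) (x : R) :
  exists2 z : int, dist_int x = `|x - z%:~R| &
    forall z' : int, `|x - z%:~R| <= `|x - z'%:~R|.
Proof.
suff [z hz] : exists z : int, forall z' : int, `|x - z%:~R| <= `|x - z'%:~R|.
  by exists z => //; apply: inf_min; [exists z|move=> _ [z' _ <-]].
have /andP[f1 f2] := floor_itv x.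
set f := Num.floor x in f1 f2.
have key (z' : int) : z'%:~R <= f%:~R :> R \/ (f + 1)%:~R <= z'%:~R :> R.
  by rewrite !ler_int; case: (leP z' f) => h; [left|right; rewrite lezD1].
rewrite intrD in key f2.
have [h|h] := leP (x - f%:~R) (f%:~R + 1 - x).
- exists f => z'; have [k|k] := key z'.
  + by rewrite !ger0_norm; lra.
  + by rewrite ger0_norm ?ler0_norm; lra.
- exists (f + 1) => z'; rewrite intrD; have [k|k] := key z'.
  + by rewrite ler0_norm ?ger0_norm; lra.
  + by rewrite !ler0_norm; lra.
Qed.

Lemma min_upto_attained (R : realType) (f : nat -> R) (t : R) : 1 <= t ->
  exists q : nat, [/\ (0 < q)%N, q%:R <= t, min_upto f t = f q &
    forall q' : nat, (0 < q')%N -> q'%:R <= t -> f q <= f q'].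
Proof.
move=> t1; have t0 : 0 <= t by apply: le_trans t1.
have truncE (q : nat) : (q%:R <= t) = (q <= Num.truncn t)%N.
  by rewrite truncn_ge_nat.
have n1 : (0 < Num.truncn t)%N by rewrite -truncE.
pose n := Num.truncn t.
have H0 : (0 < (inord 1 : 'I_n.+1))%N by rewrite inordK.
have := @arg_minP _ _ _ (inord 1 : 'I_n.+1) (fun i => (0 < i)%N)
  (fun i : 'I_n.+1 => f i) H0.
case=> i i0 imin; exists i.
have it : (i%:R : R) <= t by rewrite truncE -ltnS.
have hm (q' : nat) : (0 < q')%N -> q'%:R <= t -> f i <= f q'.
  move=> q0; rewrite truncE -ltnS => qn.
  by have := imin (Ordinal qn) q0.
split => //; apply: inf_min; first by exists i.
by move=> _ [q' [q0 qt] <-]; exact: hm.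
Qed.

Lemma largest_root_G (R : realType) (w : R) : exists g, largest_root (G w) g.
Proof.
have rootG x : root (G w) x = (x ^+ 2 - (w ^+ 2 - 2 * w + 3) * x + 1 == 0).
  by rewrite /root /G !hornerE.
have b2 : 0 <= (w ^+ 2 - 2 * w + 3) - 2.
  have -> : (w ^+ 2 - 2 * w + 3) - 2 = (w - 1) ^+ 2 by ring.
  exact: sqr_ge0.
move: rootG b2; set b := _ + 3 => rootG b2.
have d0 : 0 <= b ^+ 2 - 4 by nra.
pose s := Num.sqrt (b ^+ 2 - 4).
have s2 : s ^+ 2 = b ^+ 2 - 4 by rewrite sqr_sqrtr.
have s0 : 0 <= s by exact: sqrtr_ge0.
exists ((b + s) / 2); split.
  by rewrite rootG; apply/eqP; nra.
move=> y; rewrite rootG => /eqP hy; rewrite leNgt; apply/negP => hlt.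
have : (y - (b + s) / 2) * (y - (b - s) / 2) = 0 by nra.
move/eqP; rewrite mulf_eq0 => /orP[] /eqP; lra.
Qed.

(* Main.v *)
(* Let a > max(omega theta, omega eta) - 1 and b < w - 1, and let
   f q = min(q ||q theta||, q ||q eta||).  If x < y < z are consecutive large
   records of f, then x^(-a) <= f x <= y^(-b) / 2, and similarly for y, z.  Two
   of the three records come from the same number.  If p < q do, then the
   determinant of the corresponding fractions is nonzero, so p <= 2 q f(p), a
   lower bound on q of the form p s^b <= q, where s is the record after p.
   In the alternating case p = x, q = z this reads x y^b <= z; with
   z^b <= y^a and y^b <= x^a it gives b^2 (1 + a) <= a^2, and the case of
   consecutive p, q gives more.  For b = w - 1 equality means G w (1 + a) = 0. *)

Require Import Defs.
From mathcomp Require Import all_boot all_order all_algebra.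
From mathcomp Require Import all_classical all_reals all_analysis.
From mathcomp Require Import ring lra.
Import Order.TTheory GRing.Theory Num.Theory.
Import numFieldNormedType.Exports.
Local Open Scope classical_set_scope.
Local Open Scope ring_scope.

(** * Eventual bounds drawn from limits along [+oo] *)

Lemma limf_esup_lty_bounded {R : realType} (f : R -> R) :
  (limf_esup (fun t => (f t)%:E) +oo%R < +oo)%E ->
  exists M T : R, forall t, T < t -> f t <= M.
Proof.
move=> /ereal_inf_lt[_ [V [T [_ TV]] <-] supV].
have [M supM] : exists M : R, (ereal_sup [set (f t)%:E | t in V] <= M%:E)%E.
  case: (ereal_sup _) supV => [r _| |_] //; first by exists r.
  by exists 0; rewrite leNye.
exists M, T => t /TV Vt; rewrite -lee_fin; apply: le_trans supM.
by apply: ereal_sup_ubound; exists t.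
Qed.

Lemma limf_einf_pinfty_lb {R : realType} (f : R -> R) (M : R) :
  ~ (limf_einf (fun t => (f t)%:E) +oo%R < +oo)%E ->
  exists T : R, forall t, T < t -> M <= f t.
Proof.
move=> /negP; rewrite -leNgt limf_einfE => einf.
have /ereal_sup_gt[_ [V [T [_ TV]] <-] infV] := lt_le_trans (ltry M) einf.
exists T => t /TV Vt; rewrite -lee_fin; apply: le_trans (ltW infV) _.
by apply: ereal_inf_lbound; exists t.
Qed.

(** * Approximations to a single number *)

Lemma dist_int_gt0 {R : realType} (theta : R) (q : nat) :
  irrational theta -> (0 < q)%N -> 0 < dist_int (q%:R * theta).
Proof.
move=> irr q0; have [z -> _] := dist_int_attained (q%:R * theta).
rewrite normr_gt0; apply/eqP => h; apply: irr.
exists (z%:~R / q%:R) => //.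
rewrite rmorphM /= fmorphV /= ratr_int ratr_nat.
have qn0 : (q%:R : R) != 0 by rewrite pnatr_eq0 -lt0n.
by apply: (mulIf qn0); rewrite divfK //; lra.
Qed.

Definition qdist {R : realType} (theta : R) (q : nat) : R :=
  q%:R * dist_int (q%:R * theta).

Lemma qdist_gt0 {R : realType} (theta : R) (q : nat) :
  irrational theta -> (0 < q)%N -> 0 < qdist theta q.
Proof. by move=> irr q0; rewrite mulr_gt0 ?ltr0n ?dist_int_gt0. Qed.

(** With nearest integers [zp] and [zq], a nonzero determinant gives 1 <= q ||p theta|| + p ||q
    theta||. The last term is at most q ||q theta|| <= 1/2, so q ||p theta|| >= 1/2; multiply by
    2p. *)
Lemma qdist_decr_gap {R : realType} (theta : R) (p q : nat) :
  (0 < p)%N -> (p < q)%N -> qdist theta q < qdist theta p ->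
  2 * qdist theta q <= 1 -> p%:R <= 2 * q%:R * qdist theta p.
Proof.
rewrite /qdist => p0 pq.
have [zp -> _] := dist_int_attained (p%:R * theta).
have [zq -> _] := dist_int_attained (q%:R * theta).
set u := `|p%:R * _ - _|; set v := `|q%:R * _ - _| => dec small.
have P0 : 0 < p%:R :> R by rewrite ltr0n.
have PQ : p%:R < q%:R :> R by rewrite ltr_nat.
have v0 : 0 <= v by exact: normr_ge0.
have u0 : 0 <= u by exact: normr_ge0.
have qu : q%:R * u = `|q%:R * (p%:R * theta - zp%:~R)|.
  by rewrite normrM ger0_norm //; lra.
have pv : p%:R * v = `|p%:R * (q%:R * theta - zq%:~R)|.
  by rewrite normrM ger0_norm //; lra.
(* Equal fractions would give q ||q theta|| = (q/p)^2 p ||p theta||, so that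
   [qdist] would increase. *)
have [det|det] := eqVneq (p%:Z * zq) (q%:Z * zp).
  have eqpq : p%:R * zq%:~R = q%:R * zp%:~R :> R.
    by have := congr1 (fun z : int => z%:~R : R) det; rewrite !intrM.
  have : q%:R * u = p%:R * v.
    by rewrite qu pv; congr `|_|; rewrite !mulrBr eqpq; ring.
  move=> uv; exfalso.
  have : u <= v by nra.
  nra.
have : 1 <= q%:R * u + p%:R * v.
  rewrite qu pv -[X in _ + X]normrN.
  apply: le_trans (ler_normD _ _).
  have -> : q%:R * (p%:R * theta - zp%:~R) + - (p%:R * (q%:R * theta - zq%:~R))
     = (p%:Z * zq - q%:Z * zp)%:~R :> R by rewrite intrB !intrM; ring.
  by rewrite -intr_norm (ler_int _ 1) -gtz0_ge1 normr_gt0 subr_eq0.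
move=> one_le; have pv_qv : p%:R * v <= q%:R * v by rewrite ler_wpM2r // ltW.
have : 1 <= 2 * (q%:R * u) by lra.
nra.
Qed.

(** * Bounds implied by the two exponents *)

Definition qdist2 {R : realType} (theta eta : R) (q : nat) : R :=
  Num.min (qdist theta q) (qdist eta q).

Lemma upsilon2_attained {R : realType} (theta eta t : R) : 1 <= t ->
  exists p : nat, [/\ (0 < p)%N, p%:R <= t &
    qdist2 theta eta p <= upsilon2 theta eta t].
Proof.
move=> t1; rewrite /upsilon2 /upsilon.
have [p [p0 pt -> _]] := min_upto_attained (fun q => q%:R * dist_int (q%:R * theta)) t1.
have [r [r0 rt -> _]] := min_upto_attained (fun q => q%:R * dist_int (q%:R * eta)) t1.
have [h|h] := leP (p%:R * dist_int (p%:R * theta)) (r%:R * dist_int (r%:R * eta)).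
  by exists p; split; rewrite // /qdist2 ge_min lexx.
by exists r; split; rewrite // /qdist2 ge_min lexx orbT.
Qed.

(** Evaluating at t = q / 2 forces p < q strictly. An exponent c > b leaves a factor q^(c - b) that
    absorbs the constants 2, 2^c and M. *)
Lemma varpi_upsilon_gt_qdist2_le {R : realType} (theta eta b : R) :
  irrational theta -> irrational eta ->
  ((1 + b)%:E < varpi_upsilon theta eta)%E ->
  exists N : nat, forall q : nat, (N <= q)%N ->
    exists p : nat, [/\ (0 < p)%N, (p < q)%N &
      2 * qdist2 theta eta p * q%:R `^ b <= 1].
Proof.
move=> itheta ieta /ereal_sup_gt[_ [c' /= hc <-]]; rewrite lte_fin => bc.
have [M [T MT]] := limf_esup_lty_bounded _ hc.
pose c := c' - 1; have c_b : 0 < c - b by rewrite /c; lra.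
pose K := Num.max 1 (2 * 2 `^ c * M).
have K0 : 0 <= K by rewrite le_max ler01.
(* Beyond [A], three things hold: q / 2 >= 1, q / 2 > T and q^(c - b) >= K. *)
pose A := Num.max (Num.max 2 (2 * T)) (K `^ (c - b)^-1).
exists (Num.truncn A).+1 => q Nq.
have Aq : A < q%:R by rewrite (lt_le_trans (truncnS_gt _)) // ler_nat.
move: Aq; rewrite !gt_max -andbA => /and3P[q2 qT qK].
have q0 : 0 < q%:R :> R by lra.
have t1 : 1 <= q%:R / 2 :> R by lra.
have tT : T < q%:R / 2 by lra.
have [p [p0 pt fp]] := upsilon2_attained theta eta _ t1.
exists p; split=> //; first by rewrite -(ltr_nat R); lra.
have {}fp : (q%:R / 2) `^ c * qdist2 theta eta p <= M.
  by apply: le_trans (MT _ tT); rewrite ler_wpM2l ?powR_ge0.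
have Kq : K <= q%:R `^ (c - b).
  have -> : K = (K `^ (c - b)^-1) `^ (c - b) by rewrite -powRrM mulVf ?powRr1 ?gt_eqF.
  by rewrite ge0_ler_powR ?nnegrE ?powR_ge0 ?ltW.
have qc : q%:R `^ c = 2 `^ c * (q%:R / 2) `^ c.
  by rewrite -powRM; [rewrite mulrC divfK | lra | lra].
have qcb : q%:R `^ c = q%:R `^ (c - b) * q%:R `^ b.
  by rewrite -powRD ?subrK // (gt_eqF q0) implybT.
have two0 : 0 < 2 `^ c :> R by rewrite powR_gt0.
have D0 : 0 < q%:R `^ (c - b) by rewrite powR_gt0.
have KM : 2 * 2 `^ c * M <= q%:R `^ (c - b).
  by apply: le_trans Kq; rewrite le_max lexx orbT.
rewrite -(ler_pM2l D0) mulr1; apply: le_trans KM.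
have -> : q%:R `^ (c - b) * (2 * qdist2 theta eta p * q%:R `^ b) =
    2 * 2 `^ c * ((q%:R / 2) `^ c * qdist2 theta eta p).
  transitivity (2 * qdist2 theta eta p * (q%:R `^ (c - b) * q%:R `^ b)); first by ring.
  by rewrite -qcb qc; ring.
by rewrite ler_pM2l ?mulr_gt0.
Qed.

(** Past the supremum the lower limit is infinite, so t^(1 + a) psi(t) >= 1 eventually; take t = q,
    where psi(q) <= ||q theta||. *)
Lemma omega_lt_qdist_ge {R : realType} (theta a : R) :
  (omega theta < (1 + a)%:E)%E ->
  exists N : nat, forall q : nat, (N <= q)%N -> 1 <= qdist theta q * q%:R `^ a.
Proof.
move=> omlt.
have [] := limf_einf_pinfty_lb (fun t => t `^ (1 + a) * psi theta t) 1.
  move=> h; move: omlt; rewrite ltNge => /negP; apply.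
  by apply: ereal_sup_ubound; exists (1 + a).
move=> T hT; pose A := Num.max 1 T.
exists (Num.truncn A).+1 => q Nq.
have : A < q%:R by rewrite (lt_le_trans (truncnS_gt _)) // ler_nat.
rewrite gt_max => /andP[q1 /hT/le_trans]; apply.
have [r [_ _ psiE rmin]] := min_upto_attained (fun q => dist_int (q%:R * theta)) (ltW q1).
have q0 : (0 < q)%N by rewrite -(ltr_nat R); lra.
have qpos : 0 < q%:R :> R by rewrite ltr0n.
rewrite powRD ?(gt_eqF qpos) ?implybT // powRr1 ?ler0n // /qdist.
rewrite mulrAC ler_wpM2r ?powR_ge0 // ler_wpM2l ?ler0n //.
by rewrite /psi psiE rmin.
Qed.

(** * Successive records of a sequence *)

Definition is_record {R : realType} (f : nat -> R) (p : nat) : Prop :=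
  (0 < p)%N /\ forall p', (0 < p')%N -> (p' < p)%N -> f p < f p'.

(** Take the least [q] with [f q < f p]. The last clause lets an upper bound on any value before [q]
    pass to [f p]. *)
Lemma next_record {R : realType} (f : nat -> R) (p : nat) :
  (exists2 q, (0 < q)%N & f q < f p) -> is_record f p ->
  exists q, [/\ is_record f q, (p < q)%N &
    forall p', (0 < p')%N -> (p' < q)%N -> f p <= f p'].
Proof.
move=> [q0 q0pos fq0] [p0 precord].
have exq : exists q, (0 < q)%N && (f q < f p) by exists q0; rewrite q0pos.
case: (ex_minnP exq) => q /andP[qpos fq] qmin.
have below p' : (0 < p')%N -> (p' < q)%N -> f p <= f p'.
  move=> p'0 p'q; rewrite leNgt; apply/negP => fp'.
  by have := qmin p'; rewrite p'0 fp' leqNgt p'q => /(_ isT).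
exists q; split=> //; first by split=> // p' p'0 /below h; apply: lt_le_trans (h p'0).
rewrite ltnNge; apply/negP; rewrite leq_eqVlt => /predU1P[qp|qp].
  by rewrite qp ltxx in fq.
by have := precord _ qpos qp; rewrite ltNge (ltW fq).
Qed.

Lemma record_ge {R : realType} (f : nat -> R) :
  (forall p, (0 < p)%N -> exists2 q, (0 < q)%N & f q < f p) ->
  forall N : nat, exists2 p, is_record f p & (N <= p)%N.
Proof.
move=> small; elim=> [|N [p pr Np]].
  by exists 1%N => //; split=> // -[|[]].
have [|q [qr pq _]] := @next_record _ f p _ pr; first by apply: small; case: pr.
by exists q => //; exact: leq_ltn_trans pq.
Qed.

(** The index [y] stands for the record after [x]: it is [z] itself for consecutive records, the
    middle one otherwise. Logarithms make the bound linear. *)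
Lemma record_gap_ln {R : realType} (theta eta b : R) (x y z : nat) :
  let f := qdist2 theta eta in
  (0 < x)%N -> (x < z)%N -> (0 < y)%N -> f z < f x -> 2 * f z <= 1 ->
  (f x = qdist theta x /\ f z = qdist theta z) \/
  (f x = qdist eta x /\ f z = qdist eta z) ->
  2 * f x * y%:R `^ b <= 1 -> ln x%:R + b * ln y%:R <= ln z%:R.
Proof.
move=> f x0 xz y0 fzx fz same fxy.
have gap : x%:R <= 2 * z%:R * f x.
  by case: same => -[fxE fzE]; rewrite fxE fzE in fzx *; apply: qdist_decr_gap => //;
    rewrite -fzE.
have X0 : 0 < x%:R :> R by rewrite ltr0n.
have Y0 : 0 < y%:R `^ b :> R by rewrite powR_gt0 ?ltr0n.
have Z0 : 0 < z%:R :> R by rewrite ltr0n (ltn_trans x0).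
rewrite -ln_powR -lnM ?posrE // ler_ln ?posrE ?mulr_gt0 //.
nra.
Qed.

Lemma omega_varpi_exponents {R : realType} (theta eta a b : R) :
  irrational theta -> irrational eta -> 0 < a -> 0 < b ->
  (omega theta < (1 + a)%:E)%E -> (omega eta < (1 + a)%:E)%E ->
  ((1 + b)%:E < varpi_upsilon theta eta)%E ->
  b ^+ 2 * (1 + a) <= a ^+ 2.
Proof.
move=> itheta ieta a0 b0 /omega_lt_qdist_ge[N1 h1] /omega_lt_qdist_ge[N2 h2].
move=> /(varpi_upsilon_gt_qdist2_le _ _ _ itheta ieta)[N3 h3].
pose f := qdist2 theta eta.
have f0 q : (0 < q)%N -> 0 < f q by move=> q0; rewrite lt_min !qdist_gt0.
have tag q : f q = qdist theta q \/ f q = qdist eta q.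
  by rewrite /f /qdist2; case: leP; auto.
(* The 2 makes [ln x] positive for every index [x] from [N] on. *)
pose N := maxn 2 (maxn N1 (maxn N2 N3)).
have small p : (0 < p)%N -> exists2 q, (0 < q)%N & f q < f p.
  move=> p0; have fp := f0 _ p0.
  (* This size of [q] gives q^b >= 1 / f(p), hence 2 f(r) <= f(p). *)
  pose K := (f p)^-1 `^ b^-1.
  pose q := maxn N3 (Num.truncn K).+1.
  have [r [r0 rq hr]] := h3 q (leq_maxl _ _).
  exists r => //.
  have Kq : K <= q%:R.
    by apply: le_trans (ltW (truncnS_gt K)) _; rewrite ler_nat leq_maxr.
  have : (f p)^-1 <= q%:R `^ b.
    have -> : (f p)^-1 = K `^ b.
      by rewrite -powRrM mulVf ?gt_eqF // powRr1 // invr_ge0 ltW.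
    by apply: ge0_ler_powR; rewrite ?nnegrE ?powR_ge0 ?ler0n // ltW.
  rewrite -div1r ler_pdivrMr // => hp.
  have := f0 _ r0; rewrite -/f in hr; nra.
have Nle x : (N <= x)%N -> [/\ (1 < x)%N, (N1 <= x)%N, (N2 <= x)%N & (N3 <= x)%N].
  by rewrite !geq_max => /and4P[].
have step x : is_record f x -> (N <= x)%N -> exists y,
    [/\ is_record f y, (x < y)%N, (N <= y)%N, 2 * f x * y%:R `^ b <= 1 & 2 * f x <= 1].
  move=> xr Nx; have [|y [yr xy ymin]] := next_record f x _ xr.
    by apply: small; case: xr.
  have Ny : (N <= y)%N by exact: leq_trans Nx (ltnW xy).
  (* The bound at some [p] below [y] passes to [x], since no value before the next record is less
     than [f x]. *)
  have [y1 _ _ /h3[p [p0 py hp]]] := Nle _ Ny.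
  have yb1 : 1 <= y%:R `^ b :> R.
    have /(_ 1 y%:R) := ge0_ler_powR (ltW b0).
    by rewrite powR1 !nnegrE ler01 ler0n ler1n => /(_ isT isT (ltnW y1)).
  have fxy : 2 * f x * y%:R `^ b <= 1.
    apply: le_trans hp; rewrite ler_wpM2r ?powR_ge0 //.
    by rewrite ler_wpM2l // ymin.
  exists y; split=> //; have := f0 x; case: xr => x0 _ /(_ x0) fx; nra.
have [x xr Nx] := record_ge f small N.
have [y [yr xy Ny fxy fx]] := step x xr Nx.
have [z [zr yz Nz fyz fy]] := step y yr Ny.
(* One more step supplies [2 * f z <= 1] for the determinant bound at [z]. *)
have [_ [_ _ _ _ fz]] := step z zr Nz.
have xz := ltn_trans xy yz.
have [x0 _] := xr; have [y0 ymin] := yr; have [z0 zmin] := zr.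
have growth u v : (0 < u)%N -> (0 < v)%N -> (N <= u)%N ->
    2 * f u * v%:R `^ b <= 1 -> b * ln v%:R <= a * ln u%:R.
  move=> u0 v0 /Nle[_ /h1 hu1 /h2 hu2 _] fuv.
  have fu : 1 <= f u * u%:R `^ a.
    by have [->|->] := tag u.
  have U0 : 0 < u%:R `^ a :> R by rewrite powR_gt0 ?ltr0n.
  have V0 : 0 < v%:R `^ b :> R by rewrite powR_gt0 ?ltr0n.
  rewrite -!ln_powR ler_ln ?posrE //.
  have := f0 _ u0; nra.
have gxy := growth x y x0 y0 Nx fxy.
have gyz := growth y z y0 z0 Ny fyz.
have X0 : 0 < ln x%:R :> R by rewrite ln_gt0 // ltr1n; have [] := Nle _ Nx.
have XY : ln x%:R < ln y%:R :> R by rewrite ltr_ln ?posrE ?ltr0n // ltr_nat.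
have YZ : ln y%:R < ln z%:R :> R by rewrite ltr_ln ?posrE ?ltr0n // ltr_nat.
(* Here b Y <= a X <= a (1 - b) Y gives b (1 + a) <= a, so b <= a and b^2 (1 + a) <= a b <= a^2. *)
have consecutive (X Y : R) : 0 < X -> X < Y -> b * Y <= a * X -> X + b * Y <= Y ->
    b ^+ 2 * (1 + a) <= a ^+ 2.
  move=> {}X0 {}XY g1 g2.
  have : b * (1 + a) * Y <= a * Y by nra.
  rewrite ler_pM2r; last by lra.
  nra.
have alternating : ln x%:R + b * ln y%:R <= ln z%:R :> R -> b ^+ 2 * (1 + a) <= a ^+ 2.
  move=> g; have Y0 : 0 < ln y%:R :> R by lra.
  have : b * ln x%:R + b ^+ 2 * ln y%:R <= a * ln y%:R by nra.
  (* Multiplying [h] by a and using b ln y <= a ln x eliminates ln x. *)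
  move=> h; rewrite -(ler_pM2r Y0); nra.
have fyx := ymin x x0 xy; have fzx := zmin x x0 xz; have fzy := zmin y y0 yz.
have gap := @record_gap_ln R theta eta b.
have [tx|tx] := tag x; have [ty|ty] := tag y; have [tz|tz] := tag z;
  first [ by apply: (consecutive _ _ X0 XY gxy); apply: gap => //; auto
        | by apply: (consecutive _ _ (lt_trans X0 XY) YZ gyz); apply: gap => //; auto
        | by apply: alternating; apply: (gap x y z) => //; auto ].
Qed.

Theorem theorem3 (R : realType) (theta eta w g : R)
  (htheta : irrational theta) (heta : irrational eta)
  (hw : varpi_upsilon theta eta = w%:E) (hw1 : 1 < w)
  (hg : largest_root (G w) g) :
  (g%:E <= maxe (omega theta) (omega eta))%E /\ w < g.
Proof.
have [rg gmax] := hg.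
have rootG x : root (G w) x = (x ^+ 2 - (w ^+ 2 - 2 * w + 3) * x + 1 == 0).
  by rewrite /root /G !hornerE.
have gE : g ^+ 2 - (w ^+ 2 - 2 * w + 3) * g + 1 = 0 by apply/eqP; rewrite -rootG.
have w_lt_g : w < g.
  (* The two roots sum to w^2 - 2w + 3, and the value at w is (1 - w)^3 < 0. *)
  rewrite ltNge; apply/negP => gw.
  have : w ^+ 2 - 2 * w + 3 - g <= g.
    by apply: gmax; rewrite rootG; apply/eqP; rewrite -gE; ring.
  move=> hg_le.
  have : 0 <= (w - g) * (w - (w ^+ 2 - 2 * w + 3 - g)) by apply: mulr_ge0; lra.
  have -> : (w - g) * (w - (w ^+ 2 - 2 * w + 3 - g)) = (1 - w) ^+ 3 by lra.
  by rewrite exprn_odd_ge0 //; lra.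
split=> //; rewrite leNgt; apply/negP; rewrite gt_max => /andP[otheta oeta].
(* An exponent is a priori an extended real, so a real bound below [g] replaces it. *)
have below (x : \bar R) : (x < g%:E)%E -> exists2 r : R, r < g & (x <= r%:E)%E.
  case: x => [r|//|_]; first by exists r.
  by exists 0; [lra | rewrite leNye].
have [r1 r1g or1] := below _ otheta; have [r2 r2g or2] := below _ oeta.
pose m := Num.max 1 (Num.max r1 r2).
have mg : m < g by rewrite !gt_max r1g r2g; lra.
have [m1 mr1 mr2] : [/\ 1 <= m, r1 <= m & r2 <= m].
  by rewrite /m !le_max !lexx !orbT.
(* The midpoint 1 + a of [m] and [g] lies strictly above both exponents, and m >= 1 keeps a
   positive. *)
pose a := (m + g) / 2 - 1.
have a0 : 0 < a by rewrite /a; lra.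
have a_lt : a < g - 1 by rewrite /a; lra.
(* The root equation reads (g - 1)^2 = (w - 1)^2 g, and x^2 / (1 + x) increases for x > 0. *)
have a_lt_w : a ^+ 2 < (w - 1) ^+ 2 * (1 + a).
  have : (g - 1) ^+ 2 = (w - 1) ^+ 2 * g by lra.
  set s := (w - 1) ^+ 2 => s_eq.
  have : (g - 1) * ((g - 1) * (1 + a) - a * g) > 0 by rewrite mulr_gt0 //; lra.
  nra.
pose d := (w - 1) ^+ 2 * (1 + a) - a ^+ 2.
(* Lowering w - 1 by [e] costs at most 2 e (w - 1) (1 + a) = d / 2, so at least half of the gap [d]
   remains. *)
pose e := d / (4 * (w - 1) * (1 + a)).
have den : 0 < 4 * (w - 1) * (1 + a) by rewrite !mulr_gt0 //; lra.
have dE : d = e * (4 * (w - 1) * (1 + a)) by rewrite /e divfK // gt_eqF.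
have e0 : 0 < e by rewrite divr_gt0 // subr_gt0.
have e_lt : e < w - 1.
  rewrite ltr_pdivrMr // /d; nra.
have /negP[] : ~~ ((w - 1 - e) ^+ 2 * (1 + a) <= a ^+ 2).
  by rewrite -ltNge; rewrite /d in dE; nra.
apply: (@omega_varpi_exponents R theta eta) => //.
- by lra.
- by apply: le_lt_trans or1 _; rewrite lte_fin /a; lra.
- by apply: le_lt_trans or2 _; rewrite lte_fin /a; lra.
- by rewrite hw lte_fin; lra.
Qed.
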